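(* Let $\mathbf{k}=(k_1,\dots,k_m)$ be an index (tuple of positive integers) of weight $w=k_1+\cdots+k_m$. Then the following functional equation holds in $\mathcal{A}_{2,\mathbb{Z}[t_1,\dots,t_m]}$: $$\pounds^{\mathrm{sh},\star}_{\mathcal{A}_2,\mathbf{k}}(t_1,\dots,t_m)+\Bigl(\pounds^{\mathrm{sh},\star}_{\mathcal{A}_2,(1,k_1,\dots,k_m)}(1,t_1,\dots,t_m)-\pounds^{\mathrm{sh},\star}_{\mathcal{A}_2,(k_1+1,k_2,\dots,k_m)}(t_1,\dots,t_m)\Bigr)\mathbf{p}$$ $$=\pounds^{\mathrm{sh},\star}_{\mathcal{A}_2,\{1\}^w}(\{1\}^{k_1-1},1-t_1,\{1\}^{k_2-1},1-t_2,\dots,\{1\}^{k_m-1},1-t_m)$$ $$-\pounds^{\mathrm{sh},\star}_{\mathcal{A}_2,\{1\}^w}(\{1\}^{k_1-1},1-t_1,\dots,\{1\}^{k_{m-1}-1},1-t_{m-1},\{1\}^{k_m}).$$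
   Context: For a commutative ring $R$, $\mathcal{A}_{2,R}=\left(\prod_pR/p^2R\right)/\left(\bigoplus_pR/p^2R\right)$, $p$ running over all primes; elements are written $(a_p)_p$, and two are equal iff their components agree for all but finitely many $p$. $\mathbf{p}=(p\bmod p^2)_p$. $\{1\}^r$ denotes $1$ repeated $r$ times. The finite shuffle star-multiple polylogarithm of an index $\mathbf{k}=(k_1,\dots,k_m)$ is $$\pounds^{\mathrm{sh},\star}_{\mathcal{A}_2,\mathbf{k}}(t_1,\dots,t_m)=\Bigl(\sum_{p-1\ge n_1\ge\cdots\ge n_m\ge1}\frac{t_1^{n_1-n_2}\cdots t_{m-1}^{n_{m-1}-n_m}t_m^{n_m}}{n_1^{k_1}\cdots n_m^{k_m}}\bmod p^2\Bigr)_p\in\mathcal{A}_{2,\mathbb{Z}[t_1,\dots,t_m]};$$ substitution of constants or polynomials for the variables is done componentwise. *)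

(* Defs.v *)
From HB Require Import structures.
From mathcomp Require Import all_boot all_algebra.
From mathcomp Require Import generic_quotient ring_quotient boolp.
From mathcomp Require Import mpoly.

Set Implicit Arguments.
Unset Strict Implicit.
Unset Printing Implicit Defensive.

Import GRing.Theory.
Local Open Scope ring_scope.
Local Open Scope quotient_scope.

(* The ring structure that [ring_quotient] puts on a quotient asks for a       *)
(* nonzero ring and a proper ideal. Here improper ideals must be allowed:      *)
(* R / p^2 R is the zero ring as soon as p is a unit of R.                     *)

HB.mixin Record isAbsorbing (R : comPzRingType) (S : R -> bool) := {
  absorb_subproof : forall a u : R, S u -> S (a * u)
}.

#[short(type="idealType")]
HB.structure Definition Ideal (R : comPzRingType) :=
  {S of GRing.ZmodClosed R S & isAbsorbing R S}.

Definition cquot (R : comPzRingType) (I : idealType R) : Type := Quotient.quot I.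

Section QuotientRing.
Variables (R : comPzRingType) (idealI : idealType R).
Local Notation I := (idealI : {pred R}).
Local Notation Q := (cquot idealI).

HB.instance Definition _ := GRing.Zmodule.on Q.
HB.instance Definition _ := ZmodQuotient.on Q.

Definition qproj (x : R) : Q := \pi_Q x.

Lemma qproj_eq (x y : R) : (qproj x == qproj y) = I (x - y).
Proof. by rewrite /qproj -(Quotient.idealrBE idealI). Qed.

Lemma qprojK (x : Q) : qproj (repr x) = x. Proof. exact: reprK. Qed.

Definition qone : Q := qproj 1.
Definition qmul (x y : Q) : Q := qproj (repr x * repr y).

Lemma qprojM_subproof : {morph qproj : x y / x * y >-> qmul x y}.
Proof.
move=> x y; apply/eqP; rewrite qproj_eq.
set x' := repr _; set y' := repr _.
have Ix : I (x - x') by rewrite -qproj_eq qprojK.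
have Iy : I (y - y') by rewrite -qproj_eq qprojK.
have -> : x * y - x' * y' = y * (x - x') + x' * (y - y').
  by rewrite !mulrBr addrA (mulrC y x) (mulrC y x') subrK.
by apply: rpredD; apply: absorb_subproof.
Qed.

Lemma qprojD_subproof : {morph qproj : x y / x + y >-> x + y}.
Proof. by move=> x y; rewrite /qproj; exact: (raddfD (\pi_Q)). Qed.

Lemma qmulA : associative qmul.
Proof.
move=> x y z; rewrite -[x]qprojK -[y]qprojK -[z]qprojK.
by rewrite -!qprojM_subproof mulrA.
Qed.

Lemma qmulC : commutative qmul.
Proof. by move=> x y; rewrite /qmul mulrC. Qed.

Lemma qmul1 : left_id qone qmul.
Proof. by move=> x; rewrite -[x]qprojK -qprojM_subproof mul1r. Qed.

Lemma qmulDl : left_distributive qmul +%R.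
Proof.
move=> x y z; rewrite -[x]qprojK -[y]qprojK -[z]qprojK.
by rewrite -qprojD_subproof -!qprojM_subproof -qprojD_subproof mulrDl.
Qed.

HB.instance Definition _ :=
  GRing.Zmodule_isComPzRing.Build Q qmulA qmulC qmul1 qmulDl.

Lemma qproj_zmod_morphism : zmod_morphism qproj.
Proof. by move=> x y; rewrite /qproj; exact: (raddfB (\pi_Q)). Qed.

Lemma qproj_monoid_morphism : monoid_morphism qproj.
Proof. by split=> // x y; exact: qprojM_subproof. Qed.

HB.instance Definition _ :=
  GRing.isZmodMorphism.Build R Q qproj qproj_zmod_morphism.
HB.instance Definition _ :=
  GRing.isMonoidMorphism.Build R Q qproj qproj_monoid_morphism.

End QuotientRing.

Definition primeT := {p : nat | prime p}.

Definition p2ideal (R : comPzRingType) (p : primeT) : {pred R} :=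
  fun x => `[< exists y, x = (val p ^ 2)%N%:R * y >].

Section Modp2.
Variables (R : comPzRingType) (p : primeT).

Lemma p2ideal_zmod_closed : zmod_closed (@p2ideal R p).
Proof.
split; first by apply/asboolP; exists 0; rewrite mulr0.
move=> x y /asboolP[a ->] /asboolP[b ->]; apply/asboolP; exists (a - b).
by rewrite mulrBr.
Qed.

Lemma p2ideal_absorb (a u : R) : p2ideal p u -> p2ideal p (a * u).
Proof. by move=> /asboolP[b ->]; apply/asboolP; exists (a * b); rewrite mulrCA. Qed.

HB.instance Definition _ :=
  GRing.isZmodClosed.Build R (@p2ideal R p) p2ideal_zmod_closed.
HB.instance Definition _ :=
  isAbsorbing.Build R (@p2ideal R p) p2ideal_absorb.

Definition modp2 : comPzRingType := @cquot R (@p2ideal R p).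

Definition to_modp2 : {rmorphism R -> modp2} := @qproj R (@p2ideal R p).

Lemma to_modp2_eq (x y : R) :
  to_modp2 x = to_modp2 y <-> exists z, x - y = (val p ^ 2)%N%:R * z.
Proof.
split=> [/eqP|h]; last apply/eqP; rewrite /to_modp2 /= qproj_eq.
  by move/asboolP.
exact/asboolP.
Qed.

End Modp2.

(* The inverse of x if x is invertible, and 0 otherwise. *)
Definition cinv (Q : comPzRingType) (x : Q) : Q :=
  if pselect (exists y, x * y = 1) is left e then sval (cid e) else 0.

Lemma cinvE (Q : comPzRingType) (x y : Q) : x * y = 1 -> cinv x = y.
Proof.
move=> xy1; rewrite /cinv; case: pselect => [e|[]]; last by exists y.
case: cid => z /= xz1.
by rewrite -[z]mul1r -xy1 mulrAC xz1 mul1r.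
Qed.

Lemma cinv_nat (R : comPzRingType) (p : primeT) (n : nat) :
  coprime n (val p) -> n%:R * cinv n%:R = 1 :> modp2 R p.
Proof.
move=> cop; have p2_gt0 : (0 < val p ^ 2)%N by rewrite expn_gt0 prime_gt0 ?(valP p).
have cop2 : coprime (val p ^ 2) n by rewrite coprimeXl // coprime_sym.
suff [y ny1] : exists y : modp2 R p, n%:R * y = 1 by rewrite (cinvE ny1).
have [u _ /dvdnP[v]] := Bezoutl n p2_gt0.
rewrite (eqP cop2) => uv.
exists (- u%:R); have p20 : (val p ^ 2)%N%:R = 0 :> modp2 R p.
  rewrite -(rmorph_nat (to_modp2 R p)) -(rmorph0 (to_modp2 R p)).
  by apply/to_modp2_eq; exists 1; rewrite subr0 mulr1.
have : (1 + u * n)%N%:R = 0 :> modp2 R p by rewrite uv natrM p20 mulr0.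
by rewrite mulrN -natrM mulnC natrD => /eqP; rewrite addr_eq0 eq_sym => /eqP.
Qed.

Definition prodp2 (R : comPzRingType) : Type := forall p : primeT, modp2 R p.

Section Product.
Variable R : comPzRingType.
Implicit Types f g h : prodp2 R.

HB.instance Definition _ := gen_eqMixin (prodp2 R).
HB.instance Definition _ := gen_choiceMixin (prodp2 R).

Let zero : prodp2 R := fun=> 0.
Let opp f : prodp2 R := fun p => - f p.
Let add f g : prodp2 R := fun p => f p + g p.
Let one : prodp2 R := fun=> 1.
Let mul f g : prodp2 R := fun p => f p * g p.

Fact prod_addA : associative add.
Proof. by move=> f g h; apply: functional_extensionality_dep => p; exact: addrA. Qed.
Fact prod_addC : commutative add.
Proof. by move=> f g; apply: functional_extensionality_dep => p; exact: addrC. Qed.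
Fact prod_add0 : left_id zero add.
Proof. by move=> f; apply: functional_extensionality_dep => p; exact: add0r. Qed.
Fact prod_addN : left_inverse zero opp add.
Proof. by move=> f; apply: functional_extensionality_dep => p; exact: addNr. Qed.
HB.instance Definition _ :=
  GRing.isZmodule.Build (prodp2 R) prod_addA prod_addC prod_add0 prod_addN.

Fact prod_mulA : associative mul.
Proof. by move=> f g h; apply: functional_extensionality_dep => p; exact: mulrA. Qed.
Fact prod_mulC : commutative mul.
Proof. by move=> f g; apply: functional_extensionality_dep => p; exact: mulrC. Qed.
Fact prod_mul1 : left_id one mul.
Proof. by move=> f; apply: functional_extensionality_dep => p; exact: mul1r. Qed.
Fact prod_mulDl : left_distributive mul +%R.
Proof. by move=> f g h; apply: functional_extensionality_dep => p; exact: mulrDl. Qed.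
HB.instance Definition _ := GRing.Zmodule_isComPzRing.Build (prodp2 R)
  prod_mulA prod_mulC prod_mul1 prod_mulDl.

Lemma prodB f g p : (f - g) p = f p - g p. Proof. by []. Qed.
Lemma prodM f g p : (f * g) p = f p * g p. Proof. by []. Qed.

End Product.

Definition sump2 (R : comPzRingType) : {pred prodp2 R} :=
  fun f => `[< exists s : seq primeT, forall p, p \notin s -> f p = 0 >].

Section A2.
Variable R : comPzRingType.

Lemma sump2_zmod_closed : zmod_closed (@sump2 R).
Proof.
split; first by apply/asboolP; exists [::].
move=> f g /asboolP[s fs] /asboolP[s' gs]; apply/asboolP; exists (s ++ s') => p.
by rewrite mem_cat negb_or => /andP[ps ps']; rewrite prodB fs ?gs ?subr0.
Qed.

Lemma sump2_absorb (f g : prodp2 R) : sump2 g -> sump2 (f * g).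
Proof.
move=> /asboolP[s gs]; apply/asboolP; exists s => p ps.
by rewrite prodM gs ?mulr0.
Qed.

HB.instance Definition _ :=
  GRing.isZmodClosed.Build (prodp2 R) (@sump2 R) sump2_zmod_closed.
HB.instance Definition _ :=
  isAbsorbing.Build (prodp2 R) (@sump2 R) sump2_absorb.

Definition A2 : comPzRingType := @cquot (prodp2 R) (@sump2 R).

Definition A2_of : {rmorphism prodp2 R -> A2} := @qproj (prodp2 R) (@sump2 R).

Lemma A2_of_eq (f g : prodp2 R) :
  A2_of f = A2_of g <-> exists s : seq primeT, forall p, p \notin s -> f p = g p.
Proof.
split=> [/eqP|[s h]]; last apply/eqP; rewrite /A2_of /= qproj_eq.
  by move=> /asboolP[s h]; exists s => p /h/eqP; rewrite prodB subr_eq0 => /eqP.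
by apply/asboolP; exists s => p /h; rewrite prodB => ->; rewrite subrr.
Qed.

Definition A2_p : A2 := A2_of (fun p => to_modp2 R p (val p)%:R).

(* [star_polylog k t] is the polylogarithm of index k after substitution of    *)
(* t_1, ..., t_m : R for the variables, where m = size k = size t. The exponent*)
(* n_i - n_(i+1) of t_i is n_m when i = m because the default of [nth] is 0.   *)
(* All the denominators are prime to p, so that [cinv_nat] applies to them.    *)
Definition star_polylog (k : seq nat) (t : seq R) : A2 :=
  A2_of (fun p =>
    \sum_(n : (size k).-tuple 'I_(val p) |
          let ns := map val n in sorted geq ns && all (leq 1) ns)
      let ns : seq nat := map val n in
      to_modp2 R p (\prod_(i < size k)
                      t`_i ^+ (nth 0%N ns i - nth 0%N ns i.+1)%N)
      * cinv (\prod_(i < size k) nth 0%N ns i ^ nth 0%N k i)%N%:R).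

End A2.

(* ({1}^(k_1 - 1), 1 - t_1, ..., {1}^(k_m - 1), 1 - t_m) *)
Definition dual_args (R : comPzRingType) (k : seq nat) (t : seq R) : seq R :=
  flatten [seq rcons (nseq kt.1.-1 1) (1 - kt.2) | kt <- zip k t].

(* Main.v *)
Require Import Defs.
From mathcomp Require Import all_boot all_algebra.
From mathcomp Require Import mpoly.
From mathcomp Require Import ring zify.
From mathcomp Require boolp.

Import GRing.Theory.
Local Open Scope ring_scope.

Set Implicit Arguments.
Unset Strict Implicit.
Unset Printing Implicit Defensive.

(** Truncating at [n_1 < p], a star polylogarithm is obtained by applying a word
of two operators to the unit sequence [delta] = (1, 0, 0, ...): convolution
[T_t] with the geometric sequence [t^n] ([geomconv t]) and division [D] of the
[n]-th entry by [n] ([scale]).  The sum of index [k] at [t] is the entry of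
index [p - 1] of [T_1 (D^(k_1) T_(t_1) ... D^(k_m) T_(t_m) delta)]
([sum_chains], [star_polylogE]).

The duality [t -> 1 - t] comes from the binomial transform
[(B a)_n = sum_j (-1)^j C(n,j) a_j], which obeys two rules:
[B D = T_1 D B] on sequences vanishing at 0 ([binom_scale]), and
[T_1 B T_t = T_(1-t) B] ([binom_geomconv]).  If [B x = T_1 y], they give
[B (D^k T_t x) = T_1 ((D T_1)^(k-1) D T_(1-t) y)], an equation of the same
shape, so that [B] can be pushed through a whole word, starting from the letter
next to [delta].  At that first letter [T_t delta] does not vanish at 0, and
removing its value there subtracts a second word, the one ending in ones.  The
result is an exact identity for every [n < p] ([binom_word]): the binomial
transform of the [k]-word is the difference on the right of the theorem.

It remains to recognise the left-hand side as the entry of index [p - 1] of that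
transform.  Write [H_n] for the harmonic numbers.  Modulo [p^2],
[(-1)^n C(p-1,n) = 1 - p H_n] ([signed_bin_mod_sqr]); for odd [p] the case
[n = p - 1] says that [p H_(p-1) = 0].  Hence each term of index [n_1 = n] is
multiplied by [1 + p (H_(p-1) - H_n)], and summation by parts
([abel_summation]) identifies the contribution of [H_(p-1) - H_n] with the
difference of the two correction terms ([p_correction]).  The prime 2, where
[p H_(p-1) = 2], is discarded. *)

(** * Geometric convolution, division and the binomial transform *)

Section Operators.

Variable Q : comPzRingType.
Implicit Types (a b x y : nat -> Q) (s t : Q) (iv : nat -> Q).

Definition delta (n : nat) : Q := (n == 0)%:R.

Definition geomconv t a n : Q := \sum_(j < n.+1) t ^+ (n - j) * a j.

Definition scale iv a n : Q := iv n * a n.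

Definition binom a n : Q := \sum_(j < n.+1) (-1) ^+ j * 'C(n, j)%:R * a j.

(** The integers are invertible modulo [p^2] only below [p], so that the
identities involving division hold on an initial segment of the indices. *)
Definition eq_below N a b := forall n, (n < N)%N -> a n = b n.

Lemma eq_below_trans N b a c :
  eq_below N a b -> eq_below N b c -> eq_below N a c.
Proof. by move=> ab bc n nN; rewrite ab ?bc. Qed.

Lemma geomconv0 t a : geomconv t a 0 = a 0.
Proof. by rewrite /geomconv big_ord1 subnn expr0 mul1r. Qed.

(** Together with [geomconv0] this recursion determines [geomconv t a], so that
an identity between such sequences can be checked on increments. *)
Lemma geomconvS t a n : geomconv t a n.+1 = t * geomconv t a n + a n.+1.
Proof.
rewrite /geomconv big_ord_recr /= subnn expr0 mul1r; congr (_ + _).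
rewrite big_distrr /=; apply: eq_bigr => j _.
by rewrite subSn ?leq_ord // exprS mulrA.
Qed.

Lemma geomconv_delta t n : geomconv t delta n = t ^+ n.
Proof.
elim: n => [|n IHn]; first by rewrite geomconv0 expr0.
by rewrite geomconvS IHn /delta addr0 exprS.
Qed.

Lemma eq_below_geomconv N t a b :
  eq_below N a b -> eq_below N (geomconv t a) (geomconv t b).
Proof.
move=> ab n nN; apply: eq_bigr => j _; rewrite ab //.
exact: leq_trans (ltn_ord j) nN.
Qed.

Lemma eq_below_scale N iv a b :
  eq_below N a b -> eq_below N (scale iv a) (scale iv b).
Proof. by move=> ab n nN; rewrite /scale ab. Qed.

Lemma geomconvB t a b n :
  geomconv t (fun i => a i - b i) n = geomconv t a n - geomconv t b n.
Proof. by rewrite /geomconv -sumrB; apply: eq_bigr => j _; rewrite mulrBr. Qed.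

Lemma eq_geomconv t a b : a =1 b -> geomconv t a =1 geomconv t b.
Proof. by move=> ab n; apply: eq_bigr => j _; rewrite ab. Qed.

Lemma binom0 a : binom a 0 = a 0.
Proof. by rewrite /binom big_ord1 expr0 bin0 !mul1r. Qed.

(** Pascal's rule: the binomial transform turns the shift into [1] minus the
shift. *)
Lemma binomS a n : binom a n.+1 = binom a n - binom (a \o succn) n.
Proof.
rewrite /binom big_ord_recl /= expr0 bin0.
rewrite [X in _ = X - _]big_ord_recl /= expr0 bin0 -addrA; congr (_ + _).
have -> : \sum_(j < n) (-1) ^+ (bump 0 j) * 'C(n, bump 0 j)%:R * a (bump 0 j)
  = \sum_(j < n.+1) (-1) ^+ j.+1 * 'C(n, j.+1)%:R * a j.+1.
  by rewrite big_ord_recr /= bin_small // mulr0 mul0r addr0.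
rewrite -sumrN -big_split /=; apply: eq_bigr => i _.
by rewrite /bump /= add1n binS natrD exprS; ring.
Qed.

(** The sequence [b = T_t x] satisfies [b_(n+1) = t b_n + x_(n+1)].  Its
transform [B b] then satisfies, by Pascal's rule, the recursion with multiplier
[1 - t] and source the increments of [B x]; these are the entries of [y]. *)
Lemma binom_geomconv N t x y :
  eq_below N (binom x) (geomconv 1 y) ->
  eq_below N (binom (geomconv t x)) (geomconv (1 - t) y).
Proof.
move=> xy; elim=> [|n IHn] nN.
  by rewrite binom0 !geomconv0 -binom0 xy // geomconv0.
have shift : binom (geomconv t x \o succn) n =
    t * binom (geomconv t x) n + binom (x \o succn) n.
  rewrite /binom big_distrr -big_split /=; apply: eq_bigr => j _.
  by rewrite geomconvS; ring.
have Ex : binom (x \o succn) n = - y n.+1.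
  apply: (addrI (- binom x n)); rewrite addrC.
  have -> : binom (x \o succn) n - binom x n = - binom x n.+1.
    by rewrite binomS; ring.
  by rewrite !xy // ?(ltnW nN) // geomconvS; ring.
rewrite binomS shift Ex geomconvS -IHn ?(ltnW nN) //; ring.
Qed.

(* With the convention [iv 0 = 0], division always produces a sequence vanishing
at 0, and sums from 1 may be written as sums from 0. *)
Variables (N : nat) (iv : nat -> Q).
Hypothesis iv0 : iv 0%N = 0.
Hypothesis ivP : forall n, (0 < n < N)%N -> n%:R * iv n = 1.

(** The absorption identity [j C(n+1,j) = (n+1) C(n,j-1)] shows that the
increments of [B (D a)] are the entries of [D (B a)]. *)
Lemma binom_scale a :
  a 0%N = 0 ->
  eq_below N (binom (scale iv a)) (geomconv 1 (scale iv (binom a))).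
Proof.
move=> a0; elim=> [|n IHn] nN.
  by rewrite binom0 geomconv0 /scale iv0 !mul0r.
rewrite geomconvS mul1r -IHn ?(ltnW nN) // binomS; congr (_ + _).
set c := scale iv a.
have key : binom a n.+1 = - (n.+1%:R * binom (c \o succn) n).
  rewrite /binom big_ord_recl /= a0 mulr0 add0r big_distrr -sumrN /=.
  apply: eq_bigr => j _; rewrite /bump /= add1n /c /scale.
  have jN : (0 < j.+1 < N)%N by rewrite /= (leq_ltn_trans _ nN).
  have aE : a j.+1 = j.+1%:R * (iv j.+1 * a j.+1).
    by rewrite mulrA ivP // mul1r.
  rewrite [in LHS]aE exprS.
  transitivity
    (- ((-1) ^+ j * (j.+1 * 'C(n.+1, j.+1))%N%:R * (iv j.+1 * a j.+1))).
    by rewrite natrM; ring.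
  by rewrite -mul_bin_diag natrM /=; ring.
by rewrite /scale key mulrN mulrA [iv _ * _]mulrC ivP // mul1r.
Qed.

(** The pair [(k, t)] stands for the operator [D^k T_t], the head of the list
being applied last. *)
Definition word (z : nat -> Q) (l : seq (nat * Q)) : nat -> Q :=
  foldr (fun kt a => iter kt.1 (scale iv) (geomconv kt.2 a)) z l.

Definition unit_exponents (s : seq Q) : seq (nat * Q) :=
  [seq (1%N, u) | u <- s].

Lemma word_cat z l1 l2 : word z (l1 ++ l2) = word (word z l2) l1.
Proof. exact: foldr_cat. Qed.

Lemma iter_scale0 k a : (0 < k)%N -> iter k (scale iv) a 0%N = 0.
Proof. by case: k => //= k _; rewrite /scale iv0 mul0r. Qed.

Lemma iter_scaleB k a b n :
  iter k (scale iv) (fun i => a i - b i) n =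
  iter k (scale iv) a n - iter k (scale iv) b n.
Proof. by elim: k => //= k IHk; rewrite /scale IHk mulrBr. Qed.

Lemma eq_iter_scale k a b :
  a =1 b -> iter k (scale iv) a =1 iter k (scale iv) b.
Proof. by move=> ab; elim: k => //= k IHk n; rewrite /scale IHk. Qed.

Lemma wordB a b l n :
  word (fun i => a i - b i) l n = word a l n - word b l n.
Proof.
elim: l n => //= kt l IHl n; rewrite -iter_scaleB.
by apply: eq_iter_scale => {}n; rewrite -geomconvB; apply: eq_geomconv.
Qed.

(** The arguments that one pair [(k, t)] contributes to the dual side, where all
exponents are 1. *)
Definition dualize (k : nat) (t : Q) := rcons (nseq k.-1 1) (1 - t).

(** Each [D] on the left produces a factor [T_1 D]; regrouping
[(T_1 D)^(k+1)] as [T_1 (D T_1)^k D] leaves one [T_1] in front, which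
restores the shape needed to go on with the next letter. *)
Lemma binom_iter_scale k a b : a 0%N = 0 -> eq_below N (binom a) b ->
  eq_below N (binom (iter k.+1 (scale iv) a))
    (geomconv 1 (word (scale iv b) (unit_exponents (nseq k 1)))).
Proof.
move=> a0 ab; elim: k => [|k IHk] /=.
  apply: eq_below_trans (binom_scale a0) _.
  exact/eq_below_geomconv/eq_below_scale.
apply: eq_below_trans (binom_scale _) _.
  by rewrite -iterS iter_scale0.
exact/eq_below_geomconv/eq_below_scale.
Qed.

Lemma unit_exponents_rcons (s : seq Q) u :
  unit_exponents (rcons s u) = unit_exponents s ++ [:: (1%N, u)].
Proof. by rewrite /unit_exponents map_rcons cats1. Qed.

Lemma binom_word_step k t x y : (0 < k)%N -> x 0%N = 0 ->
  eq_below N (binom x) (geomconv 1 y) ->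
  eq_below N (binom (word x [:: (k, t)]))
    (geomconv 1 (word y (unit_exponents (dualize k t)))).
Proof.
case: k => // k _ x0 xy; rewrite unit_exponents_rcons word_cat.
apply: binom_iter_scale; first by rewrite geomconv0.
exact: binom_geomconv.
Qed.

(** The base of the induction, where the sequence under [D^k] is [(t^n)_n], with
entry 1 at 0.  Subtracting [delta] makes it vanish at 0 without changing its
image under [D^k]; on the transformed side [B delta] is the constant sequence
[T_1 delta], which is the origin of the second word. *)
Lemma binom_word_last k t : (0 < k)%N ->
  eq_below N (binom (word delta [:: (k, t)]))
    (geomconv 1 (fun n => word delta (unit_exponents (dualize k t)) n
                          - word delta (unit_exponents (nseq k 1)) n)).
Proof.
case: k => // k _ n nN.
have -> : nseq k.+1 (1 : Q) = rcons (nseq k 1) 1 by elim: k => //= k ->.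
rewrite !unit_exponents_rcons !word_cat.
(* The entry at 0 is killed by the first application of [D]. *)
have dropcst : word delta [:: (k.+1, t)] =1
    iter k.+1 (scale iv) (fun n => geomconv t delta n - delta n).
  move=> i; rewrite iter_scaleB /= [X in _ - X](_ : _ = 0) ?subr0 //.
  case: i => [|i]; first by rewrite /scale iv0 mul0r.
  rewrite /scale [X in _ * X](_ : _ = 0) ?mulr0 //.
  by elim: (k) => //= j ->; rewrite mulr0.
transitivity (binom (iter k.+1 (scale iv)
    (fun n => geomconv t delta n - delta n)) n).
  by apply: eq_bigr => j _; rewrite dropcst.
have := @binom_iter_scale k (fun n => geomconv t delta n - delta n)
  (fun n => geomconv (1 - t) delta n - geomconv 1 delta n).
move=> -> //.
- apply: eq_geomconv => i; rewrite -wordB.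
  suff E a b : a =1 b -> word a (unit_exponents (nseq k 1)) =1
      word b (unit_exponents (nseq k 1)).
    by apply: E => j; rewrite /scale mulrBr.
  move=> ab; elim: (k) => //= j IHj; exact: (eq_iter_scale 1 (eq_geomconv _ _)).
- by rewrite geomconv0 subrr.
move=> i iN; have binom_delta : binom delta =1 geomconv 1 delta.
  move=> m; rewrite geomconv_delta expr1n /binom big_ord_recl /= big1.
    by rewrite expr0 bin0 !mul1r addr0.
  by move=> j _; rewrite /delta /bump /= mulr0.
rewrite -(binom_delta i) -(@binom_geomconv N t delta delta) //.
by rewrite /binom -sumrB; apply: eq_bigr => j _; rewrite mulrBr.
Qed.

Lemma word0 z l : all (leq 1) (unzip1 l) -> z 0%N = 0 -> word z l 0%N = 0.
Proof.
elim: l => //= kt l IHl /andP[k1 /IHl{}IHl] z0.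
by rewrite iter_scale0 ?k1.
Qed.

(** Induction along the word, each letter [D^k T_t] becoming a group
[(D T_1)^(k-1) D T_(1-t)] by the step above.  The induction starts at the last
letter, which is why the list is presented with that letter split off. *)
Lemma binom_word l k t : all (leq 1) (unzip1 l) -> (0 < k)%N ->
  let d := flatten [seq dualize kt.1 kt.2 | kt <- l] in
  eq_below N (binom (word delta (rcons l (k, t))))
    (geomconv 1 (fun n => word delta (unit_exponents (d ++ dualize k t)) n
                          - word delta (unit_exponents (d ++ nseq k 1)) n)).
Proof.
move=> lP k_gt0; set x := word delta [:: (k, t)].
have x0 : x 0%N = 0 by exact: iter_scale0.
rewrite /= -cats1 word_cat -/x.
elim: l lP => [_|[k1 t1] l IHl /= /andP[k1_gt0 lP]].
  exact: binom_word_last.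
apply: eq_below_trans (binom_word_step t1 k1_gt0 _ (IHl lP)) _.
  exact: word0.
move=> n nN; apply: eq_geomconv => i; rewrite wordB.
rewrite -!catA /unit_exponents.
by rewrite ![map _ (dualize k1 t1 ++ _)]map_cat !word_cat.
Qed.

End Operators.

(** * Binomial coefficients modulo the square of [p] *)

Section PCorrection.

Variables (Q : comPzRingType) (p : nat) (iv : nat -> Q).
Hypothesis ivP : forall n, (0 < n < p)%N -> n%:R * iv n = 1.
Hypothesis iv0 : iv 0%N = 0.
Hypothesis p2_eq0 : p%:R * p%:R = 0 :> Q.

(** The recursion [(n+1) C(p-1,n+1) = (p-(n+1)) C(p-1,n)] multiplies the signed
coefficient by [1 - p/(n+1)], and the cross terms die since [p^2 = 0]. *)
Lemma signed_bin_mod_sqr n : (n < p)%N ->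
  (-1) ^+ n * 'C(p.-1, n)%:R = 1 - p%:R * geomconv 1 iv n :> Q.
Proof.
elim: n => [|n IHn] nN; first by rewrite bin0 geomconv0 iv0; ring.
have step :
    n.+1%:R * 'C(p.-1, n.+1)%:R = (p%:R - n.+1%:R) * 'C(p.-1, n)%:R :> Q.
  rewrite -natrM mul_bin_left natrM -natrB; last exact: ltnW.
  by congr (_%:R * _); lia.
have -> : (-1) ^+ n.+1 * 'C(p.-1, n.+1)%:R =
    (-1) ^+ n.+1 * iv n.+1 * (n.+1%:R * 'C(p.-1, n.+1)%:R) :> Q.
  by rewrite -mulrA (mulrA (iv _)) (mulrC (iv _)) ivP // mul1r.
rewrite step.
have -> : (-1) ^+ n.+1 * iv n.+1 * ((p%:R - n.+1%:R) * 'C(p.-1, n)%:R) =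
    (n.+1%:R * iv n.+1 - p%:R * iv n.+1) * ((-1) ^+ n * 'C(p.-1, n)%:R) :> Q.
  by rewrite exprS; ring.
rewrite ivP // IHn ?(ltnW nN) // geomconvS.
transitivity (1 - p%:R * (1 * geomconv 1 iv n + iv n.+1)
  + p%:R * p%:R * (iv n.+1 * geomconv 1 iv n)); first ring.
by rewrite p2_eq0 mul0r addr0.
Qed.

(** For odd [p] the signed coefficient [(-1)^(p-1) C(p-1,p-1)] is 1. *)
Lemma p_mul_harmonic : odd p -> p%:R * geomconv 1 iv p.-1 = 0.
Proof.
move=> p_odd; have p_gt0 : (0 < p)%N by case: p p_odd.
have p1_even : odd p.-1 = false by case: (p) p_odd => //= n /negbTE.
have := @signed_bin_mod_sqr p.-1; rewrite prednK // leqnn => /(_ isT).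
rewrite binn mulr1 -signr_odd p1_even expr0 => /eqP.
by rewrite -subr_eq0 opprB addrC subrK => /eqP.
Qed.

Lemma abel_summation a n :
  geomconv 1 (scale iv (geomconv 1 a)) n =
  geomconv 1 iv n * geomconv 1 a n
  - geomconv 1 (fun i => geomconv 1 iv i * a i) n + geomconv 1 (scale iv a) n.
Proof.
elim: n => [|n IHn]; first by rewrite !geomconv0 /scale !geomconv0; ring.
rewrite !(geomconvS 1) IHn /scale !(geomconvS 1); ring.
Qed.

(** The bracket equals the sum of the [(H_(p-1) - H_n) a_n], of which only
[- H_n a_n] survives multiplication by [p]. *)
Lemma p_correction a : odd p ->
  geomconv 1 a p.-1
  + (geomconv 1 (scale iv (geomconv 1 a)) p.-1
     - geomconv 1 (scale iv a) p.-1) * p%:R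
  = binom a p.-1.
Proof.
move=> p_odd; have p_gt0 : (0 < p)%N by case: (p) p_odd.
have -> : binom a p.-1 = geomconv 1 a p.-1
    - p%:R * geomconv 1 (fun i => geomconv 1 iv i * a i) p.-1.
  rewrite /binom [in RHS]/geomconv.
  rewrite big_distrr -sumrB /=; apply: eq_bigr => j _.
  rewrite signed_bin_mod_sqr; last by rewrite -{2}(prednK p_gt0).
  by rewrite -/(geomconv 1 iv j) expr1n !mul1r mulrBl mul1r mulrA.
rewrite abel_summation.
have pH := p_mul_harmonic p_odd.
move: (geomconv 1 (fun i => _) _) (geomconv 1 a _) (geomconv 1 iv _)
  (geomconv 1 (scale iv a) _) pH.
move=> S x y z pH.
transitivity (x - p%:R * S + (p%:R * y) * x); first by ring.
by rewrite pH mul0r addr0.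
Qed.

End PCorrection.

(** * Sums over decreasing chains *)

Section TupleSums.

Lemma sum_tuple_cons (V : nmodType) m (T : finType) (P : pred (seq T))
    (F : seq T -> V) :
  \sum_(n : m.+1.-tuple T | P n) F n =
  \sum_(x : T) \sum_(n : m.-tuple T | P (x :: n)) F (x :: n).
Proof.
rewrite pair_big_dep /=.
rewrite (reindex (fun xn : T * m.-tuple T => cons_tuple xn.1 xn.2)) //=.
exists (fun n => (thead n, behead_tuple n)) => [[x n] _|n _] /=.
  by congr (_, _); apply: val_inj.
by apply: val_inj; rewrite /= [in RHS](tuple_eta n).
Qed.

Variables (Q : comPzRingType) (p : nat) (iv : nat -> Q).
Hypothesis iv0 : iv 0%N = 0.

Lemma iter_scaleE k a n : iter k (scale iv) a n = iv n ^+ k * a n.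
Proof.
by elim: k => [|k IHk] /=; rewrite ?expr0 ?mul1r // /scale IHk exprS mulrA.
Qed.

(** The entry of [ns] past the end is 0, so that the last exponent is the last
entry itself, as in [star_polylog]. *)
Definition chain_term (k : seq nat) (u : seq Q) (ns : seq nat) : Q :=
  \prod_(i < size k) (u`_i ^+ (nth 0%N ns i - nth 0%N ns i.+1)
                      * iv (nth 0%N ns i) ^+ nth 0%N k i).

(** The bound [N] on the largest entry plays the role of a preceding entry [n_0]
with argument [s]; this makes the sum over chains satisfy the same recursion as
[word], and [s = 1] recovers the unweighted sum. *)
Lemma sum_chains k u s N : size u = size k -> all (leq 1) k -> (N < p)%N ->
  \sum_(n : (size k).-tuple 'I_p |
      path geq N (map val n) && all (leq 1) (map val n))
    s ^+ (N - head 0%N (map val n)) * chain_term k u (map val n)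
  = geomconv s (word iv (delta Q) (zip k u)) N.
Proof.
elim: k u s N => [|k0 k IHk] [|u0 u] s N //=.
  move=> _ _ _; rewrite geomconv_delta (bigD1 [tuple]) //= big1 => [|n].
    by rewrite /chain_term big_ord0 mulr1 subn0 addr0.
  by move=> /andP[_ /eqP[]]; apply: val_inj; case: n => -[].
move=> [uk] /andP[k0_gt0 k_gt0] Np.
rewrite (sum_tuple_cons _ (fun n : seq 'I_p =>
    path geq N (map val n) && all (leq 1) (map val n))
  (fun n => s ^+ (N - head 0%N (map val n))
            * chain_term (k0 :: k) (u0 :: u) (map val n))).
rewrite /geomconv.
pose G j := s ^+ (N - j) * iter k0 (scale iv)
   (geomconv u0 (word iv (delta Q) (zip k u))) j.
rewrite (big_ord_widen p G) //.
rewrite [RHS]big_mkcond /=.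
apply: eq_bigr => x _.
case: (ltnP x N.+1) => [xN|Nx]; last first.
  rewrite big1 // => n; rewrite /= -andbA => /andP[].
  by rewrite leqNgt Nx.
have [x0|x_gt0] := posnP x.
  rewrite big1 => [|n]; last by rewrite /= x0 andbF.
  by rewrite /G x0 iter_scale0 ?mulr0 ?k0_gt0.
rewrite /G iter_scaleE -(IHk u u0 x) // !big_distrr /=.
apply: eq_big => [n|n _].
  by rewrite /= -ltnS xN.
rewrite /= {1}/chain_term big_ord_recl /= nth0.
by rewrite -/(chain_term k u _); ring.
Qed.

End TupleSums.

(** * Components of star polylogarithms *)

Section Components.

Variable R : comPzRingType.
Implicit Types (p : primeT) (k : seq nat) (t : seq R).

Definition inv_mod p (n : nat) : modp2 R p := cinv n%:R.

(** [R / p^2 R] may be the zero ring, in which 0 is invertible; there the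
inverse is 0 as well. *)
Lemma inv_mod0 p : inv_mod p 0 = 0.
Proof.
rewrite /inv_mod /cinv; case: boolp.pselect => [[y]|] // y1.
case: boolp.cid => z /=; rewrite !mul0r => z1.
by rewrite -[z]mul1r -z1 mul0r.
Qed.

Lemma inv_modP p n : (0 < n < val p)%N -> n%:R * inv_mod p n = 1.
Proof.
move=> /andP[n_gt0 np]; apply: cinv_nat.
by rewrite coprime_sym prime_coprime ?(valP p) // gtnNdvd.
Qed.

Lemma p_sqr0 p : (val p)%:R * (val p)%:R = 0 :> modp2 R p.
Proof.
rewrite -natrM -(rmorph_nat (to_modp2 R p)) -(rmorph0 (to_modp2 R p)).
by apply/to_modp2_eq; exists 1; rewrite subr0 mulr1 mulnn.
Qed.

(** The bound [n_1 < p] is a bound [N = p - 1] in [sum_chains], and the inverse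
of the product of the denominators splits because each of them is prime to
[p]. *)
Lemma star_polylogE k t : size t = size k -> all (leq 1) k ->
  star_polylog k t = A2_of R (fun p =>
    geomconv 1 (word (inv_mod p) (delta _) (zip k (map (to_modp2 R p) t)))
      (val p).-1).
Proof.
move=> tk k_gt0; congr (A2_of R _).
apply: boolp.functional_extensionality_dep => p.
have p_gt0 := prime_gt0 (valP p).
rewrite -(@sum_chains _ (val p)) ?size_map ?prednK ?inv_mod0 //.
apply: eq_big => [n|n /andP[_ n_gt0]].
  congr (_ && _); case: (tval n) => //= x ns.
  by rewrite -ltnS prednK ?ltn_ord.
rewrite expr1n mul1r /chain_term big_split /=; congr (_ * _).
  rewrite rmorph_prod; apply: eq_bigr => i _.
  by rewrite rmorphXn (nth_map 0) ?tk.
apply: cinvE; rewrite natr_prod -big_split /= big1 // => i _.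
rewrite natrX -exprMn inv_modP ?expr1n //.
have i_n : (i < size (map val n))%N by rewrite size_map size_tuple.
rewrite (allP n_gt0) ?mem_nth //=.
by rewrite (nth_map (Ordinal p_gt0)) ?size_tuple.
Qed.

End Components.

(** * The functional equation *)

Section Duality.

Variable R : comPzRingType.
Implicit Types (p : primeT) (k : seq nat) (t : seq R).

Lemma map_dual_args (S : comPzRingType) (f : {rmorphism R -> S}) k t :
  map f (dual_args k t) =
  flatten [seq dualize kt.1 kt.2 | kt <- zip k (map f t)].
Proof.
rewrite /dual_args; elim: k t => [|k0 k IHk] [|t0 t] //=.
by rewrite map_cat IHk map_rcons map_nseq rmorphB rmorph1.
Qed.

Lemma size_dual_args k t :
  size t = size k -> all (leq 1) k -> size (dual_args k t) = sumn k.
Proof.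
rewrite /dual_args.
elim: k t => [|k0 k IHk] [|t0 t] //= [tk] /andP[k0_gt0 k_gt0].
by rewrite size_cat IHk // size_rcons size_nseq prednK.
Qed.

Lemma star_polylog_unit_exponentsE t :
  star_polylog (nseq (size t) 1%N) t = A2_of R (fun p =>
    geomconv 1 (word (inv_mod R p) (delta _)
                  (unit_exponents (map (to_modp2 R p) t)))
      (val p).-1).
Proof.
rewrite star_polylogE ?size_nseq ?all_nseq ?orbT //; congr (A2_of R _).
apply: boolp.functional_extensionality_dep => p.
congr (geomconv _ (word _ _ _) _).
by elim: t => //= t0 t ->.
Qed.

(** The functional equation for arbitrary values of the variables in any
commutative ring, with the last entries of [k] and [t] singled out because the
two terms on the right differ only there. *)
Lemma star_polylog_duality k t (k1 : nat) (t1 : R) :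
  size t = size k -> all (leq 1) k -> (0 < k1)%N ->
  let k' := rcons k k1 in let t' := rcons t t1 in
  star_polylog k' t'
  + (star_polylog (1%N :: k') (1 :: t')
     - star_polylog ((head 0%N k').+1 :: behead k') t') * A2_p R
  = star_polylog (nseq (sumn k') 1%N) (dual_args k' t')
    - star_polylog (nseq (sumn k') 1%N) (dual_args k t ++ nseq k1 1).
Proof.
move=> tk k_gt0 k1_gt0 k' t'.
have tk' : size t' = size k' by rewrite !size_rcons tk.
have k'_gt0 : all (leq 1) k' by rewrite all_rcons k1_gt0.
have dE : dual_args k' t' = dual_args k t ++ rcons (nseq k1.-1 1) (1 - t1).
  by rewrite /dual_args zip_rcons // map_rcons flatten_rcons.
rewrite -{1}(size_dual_args tk') //.
have -> : sumn k' = size (dual_args k t ++ nseq k1 (1 : R)).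
  by rewrite size_cat size_nseq size_dual_args // /k' -cats1 sumn_cat /= addn0.
rewrite !star_polylog_unit_exponentsE dE.
rewrite (star_polylogE tk' k'_gt0) (@star_polylogE R (1%N :: k') (1 :: t'));
  [| by rewrite /= tk' | by []].
have k'E : k' = head 0%N k' :: behead k' by rewrite /k'; case: (k).
rewrite (@star_polylogE R (_ :: behead k') t'); first last.
- by have := k'_gt0; rewrite k'E => /andP[].
- by rewrite tk' k'E.
rewrite /A2_p -rmorphB -rmorphM -rmorphD -rmorphB.
apply/A2_of_eq.
have p2 : prime 2 by [].
exists [:: exist _ 2 p2] => p; rewrite inE => p_neq2.
have p_odd : odd (val p).
  case: (even_prime (valP p)) => // pE; case/eqP: p_neq2; exact: val_inj.
have p_gt0 := prime_gt0 (valP p).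
set f := to_modp2 R p; set iv := inv_mod R p.
have iv0 : iv 0%N = 0 := inv_mod0 R p.
have ivP := @inv_modP R p.
pose l := zip k (map f t).
have lE : zip k' (map f t') = rcons l (k1, f t1).
  by rewrite /k' /t' map_rcons zip_rcons // size_map.
have l1 : unzip1 l = k by rewrite /l unzip1_zip // size_map tk.
set a := word iv (delta _) (rcons l (k1, f t1)).
(* Raising the first exponent by one applies [D] once more. *)
have raise_head z (h : nat) r (us : seq (modp2 R p)) :
    size us = (size r).+1 ->
    word iv z (zip (h.+1 :: r) us) = scale iv (word iv z (zip (h :: r) us)).
  by case: us.
pose W c := geomconv 1 (word iv (delta (modp2 R p)) c) (val p).-1.
rewrite -[LHS]/(W (zip k' (map f t')) + (W (zip (1%N :: k') (map f (1 :: t')))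
  - W (zip ((head 0%N k').+1 :: behead k') (map f t'))) * f (val p)%:R).
rewrite -[RHS]/(W (unit_exponents (map f _)) - W (unit_exponents (map f _))).
rewrite /W (raise_head _ (head 0%N k')); last by rewrite size_map tk' {1}k'E.
rewrite -k'E map_cons rmorph1 rmorph_nat /= lE -/a.
rewrite (p_correction ivP iv0 (p_sqr0 R p) a p_odd).
rewrite (@binom_word _ _ _ iv0 ivP) ?l1 ?prednK // geomconvB.
by rewrite -map_dual_args !map_cat map_rcons !map_nseq rmorphB rmorph1.
Qed.

End Duality.

Theorem theorem3p12 (m : nat) (k : m.-tuple nat)
    (m_gt0 : (0 < m)%N) (k_gt0 : all (leq 1) k) :
  let t : seq {mpoly int[m]} := [seq 'X_i | i <- enum 'I_m] in
  let w := sumn k in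
  star_polylog k t
  + (star_polylog (1%N :: k) (1 :: t)
     - star_polylog ((head 0%N k).+1 :: behead k) t) * A2_p {mpoly int[m]}
  = star_polylog (nseq w 1%N) (dual_args k t)
    - star_polylog (nseq w 1%N)
        (dual_args (take m.-1 k) (take m.-1 t) ++ nseq (last 0%N k) 1)
  :> A2 {mpoly int[m]}.
Proof.
move=> t w.
have split_last (T : Type) (z : T) (s : seq T) :
    size s = m -> s = rcons (take m.-1 s) (last z s).
  case: (lastP s) => [/= m0|s' x sm].
    by move: m_gt0; rewrite -m0.
  by rewrite -sm size_rcons last_rcons /= -cats1 take_size_cat // cats1.
have kE := split_last _ 0%N k (size_tuple k).
have tE : t = rcons (take m.-1 t) (last 0 t).
  by apply: split_last; rewrite /t size_map size_enum_ord.
have := k_gt0; rewrite {1}kE all_rcons => /andP[kl_gt0 k'_gt0].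
have tk : size (take m.-1 t) = size (take m.-1 k).
  by rewrite !size_take size_map size_enum_ord size_tuple.
have := star_polylog_duality (last 0 t) tk k'_gt0 kl_gt0.
by rewrite /= -kE -tE.
Qed.
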